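(* Let $n, z_1, z_2$ be integers with $4 \leq z_1 \leq z_2 < n \leq 2z_2-2$, and let $\mathcal{G}$ be the family, defined in the context, of $n$-dimensional non-model complex filiform Lie algebras with associated triple $(z_1,z_2,n)$. Then every $n$-dimensional filiform Lie algebra $\mathfrak{g}$ in the family $\mathcal{G}$ has derived length at most $3$, i.e. $D^3\mathfrak{g}=\{0\}$.
   Context: All Lie algebras are finite-dimensional over $\mathbb{C}$. The lower central series is $C^1\mathfrak{g}=\mathfrak{g}$, $C^k\mathfrak{g}=[C^{k-1}\mathfrak{g},\mathfrak{g}]$ for $k\ge 2$. The derived series is $D^0\mathfrak{g}=\mathfrak{g}$, $D^k\mathfrak{g}=[D^{k-1}\mathfrak{g},D^{k-1}\mathfrak{g}]$ for $k\ge1$; the derived length is the smallest $m$ with $D^m\mathfrak{g}=\{0\}$. An $n$-dimensional Lie algebra $\mathfrak{g}$ is filiform if $\dim C^k\mathfrak{g}=n-k$ for all $2\le k\le n$. A basis $\{e_1,\ldots,e_n\}$ of an $n$-dimensional filiform Lie algebra is called adapted if $[e_1,e_h]=e_{h-1}$ for $3\le h\le n$, $[e_2,e_h]=0$ for $1\le h\le n$, and $[e_3,e_h]=0$ for $2\le h\le n$. Every filiform Lie algebra admits an adapted basis. A filiform Lie algebra is called model if, with respect to an adapted basis, its only nonzero brackets are $[e_1,e_h]=e_{h-1}$, $3\le h\le n$ (up to skew-symmetry); this does not depend on the adapted basis. Every filiform Lie algebra of dimension $\le 4$ is model. For a non-model $n$-dimensional filiform Lie algebra with adapted basis $\{e_1,\dots,e_n\}$,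 put $z_1=\min\{k\ge 4 : [e_k,e_n]\ne 0\}$ and $z_2=\min\{k\ge4 : [e_k,e_{k+1}]\ne0\}$. These are invariants (independent of the adapted basis) and satisfy $4\le z_1\le z_2<n\le 2z_2-2$; the triple $(z_1,z_2,n)$ is called the triple associated with $\mathfrak{g}$. For a basis $\{e_1,\ldots,e_n\}$, $P_h(u)$ denotes the $h$-th coordinate of $u\in\mathfrak{g}$, so $u=\sum_{h=1}^n P_h(u)e_h$. Normal form: every $n$-dimensional non-model filiform Lie algebra with associated triple $(z_1,z_2,n)$ has an adapted basis $\{e_1,\ldots,e_n\}$ and complex numbers $\alpha_i$ ($1\le i\le z_2-z_1+1$), $\gamma_j$ ($1\le j\le n-z_2-1$), $\beta_{k\ell}$ ($2\le \ell\le n-z_2$, $1\le k<z_2-z_1+\ell$) such that $$[e_1,e_h]=e_{h-1}\quad (3\le h\le n),$$ $$[e_{z_1+i},e_{z_2+1}]=\alpha_1e_{i+2}+\alpha_2e_{i+1}+\cdots+\alpha_{i+1}e_2\quad (0\le i\le z_2-z_1),$$ $$[e_{z_1},e_{z_2+j}]=\alpha_1e_{j+1}+\gamma_1e_j+\cdots+\gamma_{j-1}e_2\quad (2\le j\le n-z_2),$$ $$[e_{z_1+k},e_{z_2+\ell}]=\sum_{h=2}^{k+\ell}P_h\big([e_{z_1+k-1},e_{z_2+\ell}]+[e_{z_1+k},e_{z_2+\ell-1}]\big)e_{h+1}+\beta_{k\ell}e_2\quad (2\le\ell\le n-z_2,\ 1\le k<z_2-z_1+\ell),$$ where all brackets of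 basis vectors not determined by these formulas and skew-symmetry are zero. The family $\mathcal{F}$ is the set of all such laws (with associated triple exactly $(z_1,z_2,n)$), parametrized by $(\alpha_i,\gamma_j,\beta_{k\ell})$. The family $\mathcal{G}$ is the intersection of $\mathcal{F}$ with the linear subspace of the parameter space defined by the equations $\beta_{k\ell}=\gamma_{k+\ell-1}$ for all admissible $(k,\ell)$ with $k+\ell\le n-z_2$. A Lie algebra is in the family $\mathcal{G}$ if its law is of this form in some adapted basis. *)

(* Defs.v *)
From HB Require Import structures.
From mathcomp Require Import all_boot all_order all_algebra.
From mathcomp Require Import reals.
From mathcomp Require Export complex.

Set Implicit Arguments.
Unset Strict Implicit.
Unset Printing Implicit Defensive.

Import GRing.Theory.
Local Open Scope ring_scope.

Section LieAlgebra.
Variables (K : fieldType) (g : vectType K).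
Implicit Types (br : g -> g -> g) (U V W : {vspace g}).

Record lie_bracket br : Prop := LieBracket {
  lie_linearl : forall y, linear (fun x => br x y);
  lie_linearr : forall x, linear (br x);
  lie_alternating : forall x, br x x = 0;
  lie_jacobi : forall x y z,
    br x (br y z) + br y (br z x) + br z (br x y) = 0
}.

(* [U, V], spanned by the brackets of basis vectors; lie_spaceP shows that for
   a Lie bracket this is the span of all [u, v] with u in U and v in V. *)
Definition lie_space br U V : {vspace g} :=
  <<[seq br u v | u <- vbasis U, v <- vbasis V]>>%VS.

Lemma lie_spaceP br U V W : lie_bracket br ->
  (lie_space br U V <= W)%VS <->
  (forall u v, u \in U -> v \in V -> br u v \in W).
Proof.
move=> br_lie; split=> [/subvP sW u v uU vV|sW]; last first.
  apply/span_subvP=> _ /allpairsP[[x y] /= [xU yV ->]].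
  by apply: sW; apply: vbasis_mem.
have brDl x x' y a : br (a *: x + x') y = a *: br x y + br x' y.
  exact: lie_linearl.
have brDr x y y' a : br x (a *: y + y') = a *: br x y + br x y'.
  exact: lie_linearr.
have br0l y : br 0 y = 0.
  by have := brDl 0 0 y (-1); rewrite scaler0 addr0 scaleN1r addNr.
have br0r x : br x 0 = 0.
  by have := brDr x 0 0 (-1); rewrite scaler0 addr0 scaleN1r addNr.
rewrite (coord_vbasis uU).
elim/big_ind: _ => [|x y xW yW|i _]; first by rewrite br0l mem0v.
  by have := brDl x y v 1; rewrite !scale1r => ->; rewrite memvD.
have := brDl (vbasis U)`_i 0 v (coord (vbasis U) i u).
rewrite addr0 br0l addr0 => ->; apply: memvZ.
rewrite (coord_vbasis vV).
elim/big_ind: _ => [|x y xW yW|j _]; first by rewrite br0r mem0v.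
  by have := brDr (vbasis U)`_i x y 1; rewrite !scale1r => ->; rewrite memvD.
have := brDr (vbasis U)`_i (vbasis V)`_j 0 (coord (vbasis V) j v).
rewrite addr0 br0r addr0 => ->; apply/memvZ/sW/memv_span/allpairsP.
by exists ((vbasis U)`_i, (vbasis V)`_j); rewrite !mem_nth ?size_tuple.
Qed.

(* C^k for k >= 1, with C^1 = g. *)
Definition lower_central br (k : nat) : {vspace g} :=
  iter k.-1 (fun U => lie_space br U fullv) fullv.

(* D^k for k >= 0, with D^0 = g. *)
Definition derived_series br (k : nat) : {vspace g} :=
  iter k (fun U => lie_space br U U) fullv.

Definition has_derived_length br (m : nat) : Prop :=
  derived_series br m = 0%VS /\
  (forall k, (k < m)%N -> derived_series br k <> 0%VS).

Definition filiform br (n : nat) : Prop :=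
  [/\ lie_bracket br, \dim {:g} = n &
      forall k, (2 <= k <= n)%N -> \dim (lower_central br k) = (n - k)%N].

Section Family.
Variables (br : g -> g -> g) (n : nat).
Implicit Types e : n.-tuple g.

(* The 1-based e_i; it is 0 outside the range 1 <= i <= n. *)
Definition bvec e (i : nat) : g := (0 :: e)`_i.

(* The 1-based coordinate P_h; it is 0 outside the range 1 <= h <= n. *)
Definition bcoord e (h : nat) (u : g) : K :=
  \sum_(i < n | i.+1 == h) coord e i u.

Lemma bcoordK e u : basis_of {:g} e ->
  u = \sum_(1 <= h < n.+1) bcoord e h u *: bvec e h.
Proof.
move=> be; rewrite big_add1 big_mkord [LHS](coord_basis be (memvf u)).
apply: eq_bigr => i _; by rewrite /bcoord (big_pred1 i).
Qed.

Definition adapted_basis e : Prop :=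
  [/\ basis_of {:g} e,
      forall h, (3 <= h <= n)%N -> br (bvec e 1) (bvec e h) = bvec e h.-1,
      forall h, (1 <= h <= n)%N -> br (bvec e 2) (bvec e h) = 0 &
      forall h, (2 <= h <= n)%N -> br (bvec e 3) (bvec e h) = 0].

(* Together with adaptedness, this kills every bracket of basis vectors other
   than [e_1, e_h] with 3 <= h <= n, up to skew-symmetry. *)
Definition model : Prop :=
  filiform br n /\
  exists e, adapted_basis e /\
    forall h k, (2 <= h <= n)%N -> (2 <= k <= n)%N ->
      br (bvec e h) (bvec e k) = 0.

Definition is_min (P : nat -> Prop) (m : nat) : Prop :=
  P m /\ forall k, P k -> (m <= k)%N.

Definition associated_triple e (z1 z2 : nat) : Prop :=
  is_min (fun k => [/\ (4 <= k)%N, (k <= n)%N &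
                       br (bvec e k) (bvec e n) <> 0]) z1 /\
  is_min (fun k => [/\ (4 <= k)%N, (k.+1 <= n)%N &
                       br (bvec e k) (bvec e k.+1) <> 0]) z2.

(* Parameters are total functions; only their values at the admissible indices
   are used.  The indices of the brackets [e_a, e_b], a < b, prescribed by the
   first four clauses are a = 1, 3 <= b, and z1 <= a < b, z2 < b; the last
   clause covers the others.  In the fourth clause the term h = n of the sum,
   which may occur, involves e_(n+1), read as 0: its coefficient vanishes for
   every Lie bracket of this form. *)
Definition normal_form (z1 z2 : nat) e (alpha gamma : nat -> K)
    (beta : nat -> nat -> K) : Prop :=
  [/\ forall h, (3 <= h <= n)%N -> br (bvec e 1) (bvec e h) = bvec e h.-1,
      forall i, (i <= z2 - z1)%N ->
        br (bvec e (z1 + i)) (bvec e z2.+1) =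
        \sum_(1 <= s < i.+2) alpha s *: bvec e (i + 3 - s),
      forall j, (2 <= j <= n - z2)%N ->
        br (bvec e z1) (bvec e (z2 + j)) =
        alpha 1%N *: bvec e j.+1 + \sum_(1 <= s < j) gamma s *: bvec e (j.+1 - s),
      forall k l, (2 <= l <= n - z2)%N -> (1 <= k < z2 - z1 + l)%N ->
        br (bvec e (z1 + k)) (bvec e (z2 + l)) =
        \sum_(2 <= h < (k + l).+1)
          bcoord e h (br (bvec e (z1 + k).-1) (bvec e (z2 + l)) +
                      br (bvec e (z1 + k)) (bvec e (z2 + l).-1))
            *: bvec e h.+1
        + beta k l *: bvec e 2 &
      forall a b, (1 <= a < b)%N -> (b <= n)%N ->
        ~~ ((a == 1) && (3 <= b))%N -> ~~ ((z1 <= a) && (z2 < b))%N ->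
        br (bvec e a) (bvec e b) = 0].

Definition familyF (z1 z2 : nat) e alpha gamma beta : Prop :=
  [/\ filiform br n, ~ model, adapted_basis e, associated_triple e z1 z2 &
      normal_form z1 z2 e alpha gamma beta].

Definition in_familyG (z1 z2 : nat) : Prop :=
  exists e alpha gamma beta, familyF z1 z2 e alpha gamma beta /\
    forall k l, (2 <= l <= n - z2)%N -> (1 <= k < z2 - z1 + l)%N ->
      (k + l <= n - z2)%N -> beta k l = gamma (k + l).-1.

End Family.
End LieAlgebra.

(* Main.v *)
Require Import Defs.
From HB Require Import structures.
From mathcomp Require Import all_boot all_order all_algebra reals complex.
From mathcomp Require Import zify ring.

Set Implicit Arguments.
Unset Strict Implicit.
Unset Printing Implicit Defensive.

Import Order.TTheory GRing.Theory Num.Theory.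
Local Open Scope ring_scope.

(** The span of e_2, ..., e_n is an ideal on which D = ad e_1 acts as the shift
    e_h -> e_(h-1), e_2 -> 0.  Since D is a derivation, the brackets of this
    ideal are determined by their e_2-coordinates f(a, b): the
    e_(m+2)-coordinate of [e_a, e_b] is the sum over j of
    C(m, j) f(a - m + j, b - j).  These f(a, b) are the parameters of the normal
    form.  They live on the levels a + b = z1 + z2 + w, w >= 1, with z1 <= a < b
    and b > z2; in the family G, the level w <= n - z2 carries the number
    alpha_w at b = z2 + 1 and the constant gamma_(w-1) at all larger b.

    As D^1 g is spanned by e_2, ..., e_(n-1), and e_2, ..., e_z2 commute, it is
    enough that D^2 g lies in the span of e_2, ..., e_z2.  Let w = v + 1 be the
    lowest level with a nonzero parameter and put B = z1 + z2 + v + 1.  The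
    definitions of z1 and z2 force v <= z2 - z1 and v < n - z2, so that this
    level has the form prescribed by G.  The e_h-coordinate of [e_a, e_b]
    vanishes for h > a + b + 2 - B; as distinct a, b < n satisfy
    a + b <= 2n - 3, the claim follows from the inequality 2n <= B + z2 + 1,
    which the Jacobi identity imposes on the leading coefficients, those with
    h = a + b + 2 - B (symbol_jacobi_bound).

    Up to a common factor, the leading coefficients c(a, b) are explicit
    binomial sums in one unknown alpha (symbol, bracket_coord_lead); when
    gamma_v = 0 only alpha_(v+1) survives, and (z1, v, alpha) is replaced by
    (z1 + v, 0, 1).  In the e_2-coordinate of the Jacobi identity for e_a, e_b,
    e_d with a + b + d = 2B - 2 only leading coefficients remain
    (leading_double_bracket).  For a <= z2 < b, d it reads
      s(a) c(b, d) = s(B - d) c(a, b) - s(B - b) c(a, d)   (jacobi_mixed),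
    where s(x) = c(x, B - x) for x <= z2 is 1 on z1 <= x < z1 + v, alpha at
    z1 + v, and 0 elsewhere.  The identities for indices at most m < n are
    among those for n, so to exclude 2n > B + z2 + 1 it is enough to treat
    2n = B + z2 + 2 and 2n = B + z2 + 3.
    - If z1 is at most about v, combine the identity for a = z1 + v - 1 and
      a = z1 + v - 2 with the recursion c(a, b) = c(a-1, b) + c(a, b-1): the
      unknown c(b, d) with b, d > z2 cancel, and what remains is a nonzero sum
      of numbers c(a, b) with z1 <= a < z1 + v, which are positive and do not
      involve alpha.
    - If z1 is larger, the right-hand side vanishes for b, d close to n, which
      gives c(n-1, n) = c(n-2, n-1) = 0 (or alpha = 0 and c(n-1, n) = 0, which
      positivity excludes).  By the reflection principle these two coefficients
      are sums of ballot numbers weighted by the values of s, one for each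
      position z1, ..., z1 + v, and the ratio of the ballot numbers of two
      positions changes strictly from one coefficient to the other: no alpha
      can make both vanish.
    - The cases v = 0 and v = 1, z1 = 4, 5 are settled by positivity and by
      direct computation of a few coefficients. *)

(** * Ballot numbers *)

(** The contribution to spread m x of a unit seed at y: the guard is there
    because the truncated subtraction would give 1 instead of 0 for x < y. *)
Definition npaths (y m x : nat) : nat := (y <= x) * 'C(m, x - y).

Lemma npathsS y m x : (0 < y)%N ->
  npaths y m.+1 x = (npaths y m x + npaths y m x.-1)%N.
Proof.
rewrite /npaths; case: x => [|x] y0; first by rewrite leqNgt y0.
case: (ltngtP y x.+1) => [yx|yx|->] /=.
- by rewrite -ltnS yx !mul1n subSn // binS.
- by rewrite (_ : (y <= x)%N = false) //; lia.
- by rewrite subnn !bin0 ltnn.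
Qed.

(** By reflection, the number of lattice paths from the origin to
    (m - q, q) that stay weakly above the diagonal, when m <= 2q. *)
Definition ballot (K : numFieldType) (m q : nat) : K :=
  'C(m, q)%:R - 'C(m, q.+1)%:R.

Lemma ballot_gt0 (K : numFieldType) m q :
  (q <= m)%N -> (m <= 2 * q)%N -> 0 < ballot K m q.
Proof.
move=> qm mq; have q1 : 0 < q.+1%:R :> K by rewrite ltr0n.
rewrite -(pmulr_rgt0 _ q1) /ballot mulrBr -!natrM mul_bin_left subr_gt0 ltr_nat.
by rewrite ltn_mul2r bin_gt0 qm /=; lia.
Qed.

(** Lengthening the paths by one step in each direction multiplies their number
    by an explicit rational function of q.  Its strict monotonicity in
    q >= m / 2, for fixed m, is what rules out a simultaneous zero of two
    coefficients. *)
Lemma ballotSS (K : numFieldType) m q : (q <= m)%N ->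
  (q.+2 * (m.+1 - q))%:R * ballot K m.+2 q.+1 = (m.+2 * m.+1)%:R * ballot K m q.
Proof.
move=> qm; rewrite /ballot.
set X : K := 'C(m, q)%:R; set Y : K := 'C(m, q.+1)%:R.
set U : K := 'C(m.+2, q.+1)%:R; set W : K := 'C(m.+2, q.+2)%:R.
have q1 : q.+1%:R != 0 :> K by rewrite pnatr_eq0.
have eY : q.+1%:R * Y = (m - q)%:R * X by rewrite -!natrM mul_bin_left.
have eW : q.+2%:R * W = (m.+1 - q)%:R * U.
  by rewrite -!natrM mul_bin_left subSS.
have eU : q.+1%:R * (m.+1 - q)%:R * U = (m.+2 * m.+1)%:R * X.
  rewrite -!natrM mulnAC -mul_bin_diag -mulnA; congr (_ %:R).
  by rewrite [('C(_, _) * _)%N]mulnC -mul_bin_down mulnA.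
apply: (mulfI q1).
have -> : q.+1%:R * ((q.+2 * (m.+1 - q))%:R * (U - W)) =
  q.+2%:R * (q.+1%:R * (m.+1 - q)%:R * U) -
  q.+1%:R * (m.+1 - q)%:R * (q.+2%:R * W).
  by rewrite natrM; ring.
have -> : q.+1%:R * ((m.+2 * m.+1)%:R * (X - Y)) =
  (m.+2 * m.+1)%:R * (q.+1%:R * X - q.+1%:R * Y) by ring.
rewrite eW eY.
have -> : q.+1%:R * (m.+1 - q)%:R * ((m.+1 - q)%:R * U) =
  (m.+1 - q)%:R * (q.+1%:R * (m.+1 - q)%:R * U) by ring.
rewrite eU !natrB ?(leq_trans qm) //.
by rewrite -[m.+1]addn1 -[q.+2]addn2 -[q.+1]addn1 !natrD; ring.
Qed.

(** * The Jacobi identity of the leading coefficients *)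

Lemma sum_ord_gt0 (K : numDomainType) (v : nat) (F : 'I_v -> K) : (0 < v)%N ->
  (forall i, 0 < F i) -> 0 < \sum_(i < v) F i.
Proof.
case: v F => // v F _ F_gt0; rewrite big_ord_recl ltr_wpDr //.
by apply: sumr_ge0 => i _; apply: ltW.
Qed.

(** Contradictions between sign conditions are stated in this form because the
    order of a numFieldType such as the complex numbers is only partial. *)
Lemma eq_sub_gt0_absurd (K : numDomainType) (x y : K) :
  (exists2 z, 0 < z & x - y = z \/ y - x = z) -> x = y -> False.
Proof.
by move=> [z z_gt0 zE] xy; move: z_gt0; case: zE => <-; rewrite xy subrr ltxx.
Qed.

Section Symbol.
Variables (K : numFieldType) (z1 z2 v : nat) (alpha : K).

Local Notation B := (z1 + z2 + v).+1.

(** The leading coefficient of [e_x, e_(B-x)] for x <= z2, divided by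
    the common factor: the values on the lowest level, from which all others
    arise. *)
Definition seed (x : nat) : K :=
  if (x < z1)%N then 0 else if (x < z1 + v)%N then 1
  else if x == (z1 + v)%N then alpha else 0.

(** The sum over j of C(m, j) * seed (x - j). *)
Fixpoint spread (m x : nat) : K :=
  if m is m'.+1 then spread m' x + spread m' x.-1 else seed x.

(** The e_(m+2)-coordinate of [e_a, e_b], up to the common factor, where
    m = a + b - B.  Expanding the m-th power of D by the Leibniz rule and using
    that the bracket is alternating splits the binomial sum into one term in a
    and one in b. *)
Definition symbol (a b : nat) : K :=
  spread (a + b - B) a - spread (a + b - B) b.

(** The bounds a + 2 <= B keep the index B - a at least 2, so that e_(B-a) is
    in the ideal spanned by e_2, ..., e_n. *)
Definition symbol_jacobi (n : nat) : Prop := forall a b d,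
  (2 <= a)%N -> (2 <= b)%N -> (2 <= d)%N ->
  (a <= n)%N -> (b <= n)%N -> (d <= n)%N -> (a + b + d + 2 = B + B)%N ->
  (a + 2 <= B)%N -> (b + 2 <= B)%N -> (d + 2 <= B)%N ->
  symbol a (B - a) * symbol b d + symbol b (B - b) * symbol d a
    + symbol d (B - d) * symbol a b = 0.

Lemma symbolC a b : symbol a b = - symbol b a.
Proof. by rewrite /symbol addnC opprB. Qed.

Lemma symbolaa a : symbol a a = 0.
Proof. by rewrite /symbol subrr. Qed.

Lemma symbol_rec a b : (B < a + b)%N -> (0 < a)%N -> (0 < b)%N ->
  symbol a b = symbol a.-1 b + symbol a b.-1.
Proof.
case: a => // a; case: b => // b Bab _ _; rewrite /symbol /=.
rewrite (_ : a.+1 + b.+1 - B = (a + b.+1 - B).+1)%N; last by lia.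
rewrite (_ : a.+1 + b - B = a + b.+1 - B)%N; last by lia.
by rewrite /=; ring.
Qed.

Lemma seed_low x : (x < z1)%N -> seed x = 0.
Proof. by rewrite /seed => ->. Qed.

Lemma seed_one x : (z1 <= x < z1 + v)%N -> seed x = 1.
Proof. by case/andP=> zx xv; rewrite /seed ltnNge zx xv. Qed.

Lemma seed_alpha : seed (z1 + v) = alpha.
Proof. by rewrite /seed ltnNge leq_addr ltnn eqxx. Qed.

Lemma seed_high x : (z1 + v < x)%N -> seed x = 0.
Proof.
move=> zx; rewrite /seed; case: ifP => // _.
by rewrite ifF ?ifF //; apply/negbTE; lia.
Qed.

Lemma spread_high m x : (z1 + v + m < x)%N -> spread m x = 0.
Proof.
elim: m x => [|m IHm] x zx; first by apply: seed_high; lia.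
by rewrite /= !IHm ?addr0 //; lia.
Qed.

Lemma spread_low m x : (x < z1)%N -> spread m x = 0.
Proof.
elim: m x => [|m IHm] x zx; first exact: seed_low.
by rewrite /= !IHm ?addr0 //; lia.
Qed.

Lemma symbol_base a b : (a + b = B)%N -> symbol a b = seed a - seed b.
Proof. by move=> abB; rewrite /symbol abB subnn. Qed.

Hypotheses (z1_ge4 : (4 <= z1)%N) (zv : (z1 + v <= z2)%N).

Lemma symbol_low a b : (B <= a + b)%N -> (a < z1)%N -> symbol a b = 0.
Proof.
by move=> Bab az; rewrite /symbol spread_low // spread_high ?subrr //; lia.
Qed.

Lemma symbol_abelian a b : (B <= a + b)%N -> (a <= z2)%N -> (b <= z2)%N ->
  symbol a b = 0.
Proof.
move: {2}(a + b)%N (leqnn (a + b)) => t.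
elim: t a b => [|t IHt] a b abt Bab az bz; first by lia.
have [abB|neq] := eqVneq (a + b)%N B.
  have h x y : (x + y)%N = B -> (y <= z2)%N -> seed x = 0.
    by move=> xyB yz; apply: seed_high; lia.
  by rewrite symbol_base // (h a b) // (h b a) ?subrr // addnC.
have [a0|a0] := posnP a; first by rewrite symbol_low // a0; lia.
have [b0|b0] := posnP b; first by rewrite symbolC symbol_low ?oppr0 // ?b0; lia.
by rewrite symbol_rec ?IHt ?addr0 //; lia.
Qed.

(** The number alpha sits in row z1 + v and only propagates to higher rows,
    so these coefficients are path counts from positions with value 1. *)
Lemma symbol_row_gt0 a b : (z1 <= a < z1 + v)%N -> (B <= a + b)%N ->
  0 < symbol a b.
Proof.
move: {2}(a + b)%N (leqnn (a + b)) => t.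
elim: t a b => [|t IHt] a b abt /andP[za av] Bab; first by lia.
have [abB|neq] := eqVneq (a + b)%N (z1 + z2 + v).+1.
  by rewrite symbol_base // seed_one ?za // seed_high ?subr0 ?ltr01 //; lia.
rewrite symbol_rec; [|lia..].
have [az|az] := eqVneq a z1.
  rewrite symbol_low ?add0r; [|lia..].
  by apply: IHt; lia.
by rewrite addr_gt0 // IHt //; lia.
Qed.

(** Of the six leading coefficients in a Jacobi identity, the three on the
    lowest level reduce to one value of seed each once a <= z2 < b, d. *)
Lemma jacobi_mixed n a b d : symbol_jacobi n ->
  (2 <= a <= z2)%N -> (z2 < b <= n)%N -> (z2 < d <= n)%N ->
  (b + 2 <= B)%N -> (d + 2 <= B)%N -> (a <= n)%N ->
  (a + b + d + 2 = B + B)%N ->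
  seed a * symbol b d = seed (B - d) * symbol a b - seed (B - b) * symbol a d.
Proof.
move=> jac /andP[a2 az] /andP[zb bn] /andP[zd dn] bB dB an abd.
have:= jac a b d a2 _ _ an bn dn abd _ bB dB.
rewrite (@symbol_base a) ?(@symbol_base b (B - b)) ?(@symbol_base d (B - d));
  [|lia..].
rewrite (@seed_high (B - a)) ?(@seed_high b) ?(@seed_high d); [|lia..].
move=> H; have {}H := H ltac:(lia) ltac:(lia) ltac:(lia).
by rewrite (symbolC d a) in H; rewrite -[LHS]subr0 -H; ring.
Qed.

Lemma symbol_gt0 a b : 0 < alpha ->
  (z1 <= a < b)%N -> (z2 < b)%N -> (B <= a + b)%N -> 0 < symbol a b.
Proof.
move=> alpha_gt0; move: {2}(a + b)%N (leqnn (a + b)) => t.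
elim: t a b => [|t IHt] a b abt /andP[za ab] zb Bab; first by lia.
have [abB|neq] := eqVneq (a + b)%N B.
  rewrite symbol_base // (@seed_high b) ?subr0; last by lia.
  have [-> //|az] := eqVneq a (z1 + v)%N; first by rewrite seed_alpha.
  by rewrite seed_one ?ltr01 //; lia.
rewrite symbol_rec; [|lia..].
have [az|az] := eqVneq a z1.
  by rewrite symbol_low ?add0r; [apply: IHt|..]; lia.
have lower : 0 < symbol a.-1 b by apply: IHt; lia.
have [zb1|zb1] := leqP b.-1 z2; last first.
  have [abE|ab1] := eqVneq a b.-1; first by rewrite -abE symbolaa addr0.
  by rewrite addr_gt0 // IHt //; lia.
have [az2|az2] := leqP a z2; last by exfalso; lia.
by rewrite (symbol_abelian _ az2 zb1) ?addr0 //; lia.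
Qed.

Lemma seed_bool x : (x < z1 + v)%N -> seed x = (z1 <= x)%N%:R.
Proof.
by move=> xv; case: leqP => zx; [rewrite seed_one ?zx|rewrite seed_low].
Qed.

(** The coefficients c(a, b) with z1 <= a < b and b > z2 are positive, while
    the identity for a = z1 gives c(b, n-1) a nonpositive value. *)
Lemma no_jacobi_v0 n : v = 0%N -> alpha = 1 ->
  (2 * n = z1 + 2 * z2 + 3)%N \/ (2 * n = z1 + 2 * z2 + 4)%N ->
  ~ symbol_jacobi n.
Proof.
move=> v0 alpha1 nE jac.
have alpha_gt0 : 0 < alpha by rewrite alpha1 ltr01.
have seedz1 : seed z1 = 1 by rewrite -alpha1 -seed_alpha v0 addn0.
have absurd b : (z2 < b)%N -> (b + 2 <= n)%N ->
    (b + n.-1 = z1 + 2 * z2)%N -> False.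
  move=> zb bn bE.
  have J := @jacobi_mixed n z1 b n.-1 jac ltac:(lia) ltac:(lia) ltac:(lia)
    ltac:(lia) ltac:(lia) ltac:(lia) ltac:(lia).
  move: J; rewrite seedz1 mul1r (@seed_low (B - n.-1)) ?mul0r ?sub0r;
    last by lia.
  have p1 : 0 < symbol b n.-1 by apply: symbol_gt0 => //; lia.
  have p2 : 0 < symbol z1 n.-1 by apply: symbol_gt0 => //; lia.
  have g_ge0 : 0 <= seed (B - b).
    have [->|bz] := eqVneq (B - b)%N z1; first by rewrite seedz1 ler01.
    by rewrite seed_low //; lia.
  move=> E; move: p1; rewrite E oppr_gt0.
  move=> /(le_lt_trans (mulr_ge0 g_ge0 (ltW p2))).
  by rewrite ltxx.
by case: nE => nE; [apply: (absurd (n - 2)%N)|apply: (absurd (n - 3)%N)]; lia.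
Qed.

(** With A = z1 + v - 1, the identities for (A, n-2, n) and (A-1, n-1, n)
    compute c(n-2, n) and c(n-1, n), which are equal since c(n-1, n-1) = 0.  The
    resulting relation between rows A and A - 1 contradicts positivity for each
    of the possible values 0 or 1 of seed at B - n and B - n + 1. *)
Lemma no_jacobi_odd n : (2 <= v)%N -> (z1 <= v + 3)%N ->
  (2 * n = z1 + 2 * z2 + v + 3)%N -> ~ symbol_jacobi n.
Proof.
move=> v2 zv3 nE jac; pose A := (z1 + v).-1.
have J1 : seed A * symbol (n - 2) n =
    seed (B - n) * symbol A (n - 2) - seed (B - (n - 2)) * symbol A n.
  by apply: jacobi_mixed jac _ _ _ _ _ _ _; lia.
have J2 : seed A.-1 * symbol n.-1 n =
    seed (B - n) * symbol A.-1 n.-1 - seed (B - n.-1) * symbol A.-1 n.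
  by apply: jacobi_mixed jac _ _ _ _ _ _ _; lia.
have E : symbol n.-1 n = symbol (n - 2) n.
  rewrite symbol_rec ?symbolaa ?addr0; [|lia..].
  by congr symbol; lia.
have R1 : symbol A n = symbol A.-1 n + symbol A n.-1 by apply: symbol_rec; lia.
have R2 : symbol A n.-1 = symbol A.-1 n.-1 + symbol A (n - 2).
  by rewrite symbol_rec; [congr (_ + symbol _ _); lia|lia..].
have P k b : (A.-1 <= k <= A)%N -> (n - 2 <= b)%N -> (B <= k + b)%N ->
  0 < symbol k b by move=> *; apply: symbol_row_gt0; lia.
have P1 := P A (n - 2)%N ltac:(lia) ltac:(lia) ltac:(lia).
have P2 := P A.-1 n.-1 ltac:(lia) ltac:(lia) ltac:(lia).
have P3 := P A.-1 n ltac:(lia) ltac:(lia) ltac:(lia).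
have s1 : seed A = 1 by apply: seed_one; lia.
have s2 : seed A.-1 = 1 by apply: seed_one; lia.
have s3 : seed (B - (n - 2)) = 1 by apply: seed_one; lia.
have s4 := @seed_bool (B - n) ltac:(lia).
have s5 := @seed_bool (B - n.-1) ltac:(lia).
have imp : (z1 <= B - n -> z1 <= B - n.-1)%N by lia.
move: J1 J2 imp; rewrite s1 s2 s3 s4 s5 !mul1r E => ->.
rewrite R1 R2; move=> J2 imp; apply: eq_sub_gt0_absurd J2.
case: (z1 <= B - n)%N imp; case: (z1 <= B - n.-1)%N => imp /=.
- exists (symbol A.-1 n.-1 + symbol A.-1 n.-1); last by right; ring.
  exact: addr_gt0.
- by have := imp isT.
- exists (symbol A.-1 n.-1 + symbol A (n - 2)); last by right; ring.
  exact: addr_gt0.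
- exists (symbol A.-1 n + (symbol A.-1 n.-1 + symbol A (n - 2))).
    exact: addr_gt0 P3 (addr_gt0 P2 P1).
  by right; ring.
Qed.

(** Same principle with c(n-2, n) = c(n-3, n) + c(n-2, n-1), where the three
    coefficients come from (A-1, n-2, n), (A, n-3, n) and (A, n-2, n-1). *)
Lemma no_jacobi_even n : (2 <= v)%N -> (z1 <= v + 4)%N ->
  (2 * n = z1 + 2 * z2 + v + 4)%N -> ~ symbol_jacobi n.
Proof.
move=> v2 zv4 nE jac; pose A := (z1 + v).-1.
have J1 : seed A * symbol (n - 2) n.-1 =
    seed (B - n.-1) * symbol A (n - 2) - seed (B - (n - 2)) * symbol A n.-1.
  by apply: jacobi_mixed jac _ _ _ _ _ _ _; lia.
have J2 : seed A * symbol (n - 3) n =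
    seed (B - n) * symbol A (n - 3) - seed (B - (n - 3)) * symbol A n.
  by apply: jacobi_mixed jac _ _ _ _ _ _ _; lia.
have J3 : seed A.-1 * symbol (n - 2) n =
    seed (B - n) * symbol A.-1 (n - 2) - seed (B - (n - 2)) * symbol A.-1 n.
  by apply: jacobi_mixed jac _ _ _ _ _ _ _; lia.
have E : symbol (n - 2) n = symbol (n - 3) n + symbol (n - 2) n.-1.
  by rewrite symbol_rec; [congr (symbol _ _ + _); lia|lia..].
have R1 : symbol A n = symbol A.-1 n + symbol A n.-1 by apply: symbol_rec; lia.
have R2 : symbol A n.-1 = symbol A.-1 n.-1 + symbol A (n - 2).
  by rewrite symbol_rec; [congr (_ + symbol _ _); lia|lia..].
have R3 : symbol A (n - 2) = symbol A.-1 (n - 2) + symbol A (n - 3).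
  by rewrite symbol_rec; [congr (_ + symbol _ _); lia|lia..].
have P k b : (A.-1 <= k <= A)%N -> (n - 3 <= b)%N -> (B <= k + b)%N ->
  0 < symbol k b by move=> *; apply: symbol_row_gt0; lia.
have P1 := P A (n - 3)%N ltac:(lia) ltac:(lia) ltac:(lia).
have P2 := P A.-1 n.-1 ltac:(lia) ltac:(lia) ltac:(lia).
have P3 := P A.-1 n ltac:(lia) ltac:(lia) ltac:(lia).
have P4 := P A.-1 (n - 2)%N ltac:(lia) ltac:(lia) ltac:(lia).
have s1 : seed A = 1 by apply: seed_one; lia.
have s2 : seed A.-1 = 1 by apply: seed_one; lia.
have s3 : seed (B - (n - 3)) = 1 by apply: seed_one; lia.
have s4 := @seed_bool (B - n) ltac:(lia).
have s5 := @seed_bool (B - n.-1) ltac:(lia).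
have s6 := @seed_bool (B - (n - 2)) ltac:(lia).
have imp : (z1 <= B - n -> z1 <= B - n.-1)%N by lia.
have imp' : (z1 <= B - n.-1 -> z1 <= B - (n - 2))%N by lia.
move: J1 J2 J3 imp imp'; rewrite s1 s2 s3 s4 s5 s6 !mul1r => J1 J2 J3.
rewrite E J1 J2 R1 R2 R3 in J3; move=> imp imp'; apply: eq_sub_gt0_absurd J3.
have P5 := addr_gt0 P2 (addr_gt0 P4 P1).
case: (z1 <= B - n)%N imp; case: (z1 <= B - n.-1)%N imp';
  case: (z1 <= B - (n - 2))%N => imp' imp /=;
  try by [have := imp isT|have := imp' isT].
- exists ((symbol A.-1 n.-1 + symbol A.-1 (n - 2)) *+ 2); last by right; ring.
  by rewrite pmulrn_lgt0 //; exact: addr_gt0.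
- exists (symbol A.-1 n.-1 +
          (symbol A.-1 n.-1 + (symbol A.-1 (n - 2) + symbol A (n - 3)))).
    exact: addr_gt0.
  by right; ring.
- exists ((symbol A.-1 n.-1 + (symbol A.-1 (n - 2) + symbol A (n - 3))) *+ 2).
    by rewrite pmulrn_lgt0.
  by right; ring.
- exists (symbol A.-1 n +
          (symbol A.-1 n.-1 + (symbol A.-1 (n - 2) + symbol A (n - 3)))).
    exact: addr_gt0.
  by right; ring.
Qed.

Lemma symbol_recS a b : (B < a + b + 2)%N ->
  symbol a.+1 b.+1 = symbol a b.+1 + symbol a.+1 b.
Proof. by move=> Bab; rewrite symbol_rec //; lia. Qed.

Lemma symbol_row_z1 b : v = 1%N -> (z2.+2 <= b)%N -> symbol z1 b = 1.
Proof.
move=> v1; elim: b => // b IHb; rewrite leq_eqVlt => /orP[/eqP<-|zb].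
  rewrite symbol_base ?(@seed_one z1) ?(@seed_high z2.+2) ?subr0 //; lia.
rewrite symbol_rec; [|lia..].
by rewrite symbol_low ?add0r ?IHb //; lia.
Qed.

Lemma symbol_row_z1S j : v = 1%N -> symbol z1.+1 (z2.+1 + j) = alpha + j%:R.
Proof.
move=> v1; have zE : z1.+1 = (z1 + v)%N by lia.
elim: j => [|j IHj].
  rewrite !addn0 addr0 symbol_base; last by lia.
  by rewrite zE seed_alpha seed_high ?subr0 //; lia.
rewrite addnS symbol_recS; last by lia.
rewrite IHj symbol_row_z1 //; last by lia.
by rewrite -[j.+1]addn1 natrD; ring.
Qed.

(** Only the row a = z1 has seed 1 when v = 1, so the two rows A and A - 1 of
    the previous argument are not available, and the identities for the rows
    z1 + v and beyond determine alpha in two incompatible ways. *)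
Lemma no_jacobi_v1_odd : v = 1%N -> z1 = 4%N -> (6 <= z2)%N ->
  ~ symbol_jacobi (z2 + 4).
Proof.
move=> v1 z14 z26 jac.
have row2 j := symbol_row_z1S j v1; rewrite z14 in row2.
have sa : seed 5 = alpha by rewrite (_ : 5 = z1 + v)%N ?seed_alpha //; lia.
have s4 : seed 4 = 1 by apply: seed_one; lia.
have row6_1 : symbol 6 z2.+1 = alpha.
  rewrite symbol_recS ?(@symbol_abelian 6) ?addr0; [|lia..].
  by have := row2 0%N; rewrite addn0 addr0.
have row6_2 : symbol 6 z2.+2 = 1 + 2 * alpha.
  rewrite symbol_recS ?row6_1; last by lia.
  by have := row2 1%N; rewrite addn1 => ->; ring.
have row6_3 : symbol 6 z2.+3 = 3 + 3 * alpha.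
  rewrite symbol_recS ?row6_2; last by lia.
  by have := row2 2%N; rewrite addn2 => ->; ring.
have J1 : seed 5 * symbol z2.+2 z2.+3 =
    seed (B - z2.+3) * symbol 5 z2.+2 - seed (B - z2.+2) * symbol 5 z2.+3.
  by apply: jacobi_mixed jac _ _ _ _ _ _ _; lia.
rewrite sa (@seed_low (B - z2.+3)) in J1; last by lia.
rewrite (_ : B - z2.+2 = 4)%N in J1; last by lia.
have r := row2 2%N; rewrite addn2 in r.
rewrite r s4 mul0r sub0r mul1r in J1.
(* The triple (7, z2+1, z2+2) forces alpha = 0, but needs 7 <= z2; for z2 = 6,
   (6, 7, 9) gives alpha * (3 + 3 * alpha) = 0 and c(8, 9) is computed. *)
have [z2E|z2E] := eqVneq z2 6%N.
  have J2 : seed 6 * symbol z2.+1 z2.+3 =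
      seed (B - z2.+3) * symbol 6 z2.+1 - seed (B - z2.+1) * symbol 6 z2.+3.
    by apply: jacobi_mixed jac _ _ _ _ _ _ _; lia.
  rewrite (@seed_high 6) in J2; last by lia.
  rewrite (@seed_low (B - z2.+3)) in J2; last by lia.
  rewrite (_ : B - z2.+1 = 5)%N in J2; last by lia.
  rewrite sa row6_3 !mul0r sub0r in J2.
  have c89 : symbol z2.+2 z2.+3 = 4 + 5 * alpha.
    rewrite symbol_recS ?symbolaa ?addr0; last by lia.
    have r2 : symbol z2 z2.+2 = 1 + 2 * alpha by rewrite {1}z2E.
    have r3 : symbol z2 z2.+3 = 3 + 3 * alpha by rewrite {1}z2E.
    rewrite symbol_recS ?r3; last by lia.
    by rewrite symbol_recS ?r2 ?symbolaa; [ring|lia].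
  rewrite c89 in J1; apply: eq_sub_gt0_absurd J1; exists 2 => //; left.
  (* The first triple gives a polynomial equation in alpha, to be reduced
     modulo the one from (6, 7, 9). *)
  have -> : alpha * (4 + 5 * alpha) - - (alpha + 2)
    = 2 + 5 / 3 * - - (alpha * (3 + 3 * alpha)) by field.
  by rewrite -J2 oppr0 mulr0 addr0.
have J2 : seed 7 * symbol z2.+1 z2.+2 =
    seed (B - z2.+2) * symbol 7 z2.+1 - seed (B - z2.+1) * symbol 7 z2.+2.
  by apply: jacobi_mixed jac _ _ _ _ _ _ _; lia.
rewrite (@seed_high 7) in J2; last by lia.
rewrite (_ : B - z2.+1 = 5)%N in J2; last by lia.
rewrite (_ : B - z2.+2 = 4)%N in J2; last by lia.
have row7_1 : symbol 7 z2.+1 = alpha.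
  by rewrite symbol_recS ?(@symbol_abelian 7) ?addr0; [|lia..].
have row7_2 : symbol 7 z2.+2 = 1 + 3 * alpha.
  by rewrite symbol_recS ?row7_1 ?row6_2; [ring|lia].
rewrite sa s4 row7_1 row7_2 mul0r mul1r in J2.
have alpha0 : alpha = 0.
  have neq0 : 3 != 0 :> K by rewrite pnatr_eq0.
  apply/eqP; rewrite -sqrf_eq0 -(mulrI_eq0 _ (mulfI neq0)).
  rewrite -oppr_eq0 J2; apply/eqP; ring.
by apply: eq_sub_gt0_absurd J1; exists 2 => //; left; rewrite alpha0; ring.
Qed.

(** The triples (5, z2+3, z2+4) and (6, z2+2, z2+4) give alpha = -3, whereas
    (7, z2+1, z2+4) gives alpha * (6 + 4 * alpha) = 0. *)
Lemma no_jacobi_v1_even : v = 1%N -> z1 = 5%N -> (7 <= z2)%N ->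
  ~ symbol_jacobi (z2 + 5).
Proof.
move=> v1 z15 z27 jac.
have row2 j := symbol_row_z1S j v1; rewrite z15 in row2.
have sa : seed 6 = alpha by rewrite (_ : 6 = z1 + v)%N ?seed_alpha //; lia.
have s5 : seed 5 = 1 by apply: seed_one; lia.
have row7_1 : symbol 7 z2.+1 = alpha.
  rewrite symbol_recS ?(@symbol_abelian 7) ?addr0; [|lia..].
  by have := row2 0%N; rewrite addn0 addr0.
have row7_2 : symbol 7 z2.+2 = 1 + 2 * alpha.
  rewrite symbol_recS ?row7_1; last by lia.
  by have := row2 1%N; rewrite addn1 => ->; ring.
have row7_3 : symbol 7 z2.+3 = 3 + 3 * alpha.
  rewrite symbol_recS ?row7_2; last by lia.
  by have := row2 2%N; rewrite addn2 => ->; ring.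
have row7_4 : symbol 7 z2.+4 = 6 + 4 * alpha.
  rewrite symbol_recS ?row7_3; last by lia.
  by have := row2 3; rewrite addn3 => ->; ring.
have J1 : seed 5 * symbol z2.+3 z2.+4 =
    seed (B - z2.+4) * symbol 5 z2.+3 - seed (B - z2.+3) * symbol 5 z2.+4.
  by apply: jacobi_mixed jac _ _ _ _ _ _ _; lia.
rewrite s5 (@seed_low (B - z2.+3)) ?(@seed_low (B - z2.+4)) in J1; [|lia..].
rewrite !mul0r subrr mul1r in J1.
have J2 : seed 6 * symbol z2.+2 z2.+4 =
    seed (B - z2.+4) * symbol 6 z2.+2 - seed (B - z2.+2) * symbol 6 z2.+4.
  by apply: jacobi_mixed jac _ _ _ _ _ _ _; lia.
rewrite (_ : B - z2.+2 = 5)%N in J2; last by lia.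
rewrite sa s5 (@seed_low (B - z2.+4)) in J2; last by lia.
have J3 : seed 7 * symbol z2.+1 z2.+4 =
    seed (B - z2.+4) * symbol 7 z2.+1 - seed (B - z2.+1) * symbol 7 z2.+4.
  by apply: jacobi_mixed jac _ _ _ _ _ _ _; lia.
rewrite (_ : B - z2.+1 = 6)%N in J3; last by lia.
rewrite (@seed_high 7) ?(@seed_low (B - z2.+4)) in J3; [|lia..].
have := row2 3; rewrite addn3 => r; rewrite r in J2.
have E : symbol z2.+3 z2.+4 = symbol z2.+2 z2.+4.
  by rewrite symbol_recS ?symbolaa ?addr0; [|lia].
rewrite -E J1 mulr0 mul0r mul1r sub0r in J2.
rewrite sa row7_4 !mul0r sub0r in J3.
have alpha3 : alpha = - 3 by apply/eqP; rewrite -addr_eq0 -oppr_eq0 -J2.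
apply: eq_sub_gt0_absurd J3; exists 18 => //; left.
by rewrite alpha3; ring.
Qed.

(** * Zeros of the coefficients next to the diagonal *)

Lemma spreadE m x : spread m x =
  \sum_(i < v) (npaths (z1 + i) m x)%:R + alpha * (npaths (z1 + v) m x)%:R.
Proof.
elim: m x => [|m IHm] x; last first.
  rewrite /= !IHm npathsS ?addn_gt0 ?(ltnW (ltnW (ltnW z1_ge4))) //.
  under [in RHS]eq_bigr => i _.
    rewrite npathsS ?natrD; last by lia.
    over.
  by rewrite big_split /=; ring.
have paths0 y : npaths y 0 x = (x == y).
  rewrite /npaths bin0n -/leq subn_eq0 eqn_leq andbC; case: (y <= x)%N => //.
  by rewrite mul1n.
rewrite paths0; under eq_bigr do rewrite paths0.
rewrite /= /seed; case: ltnP => zx.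
  rewrite big1 ?ltn_eqF ?mulr0 ?addr0 //; [by lia|].
  by move=> i _; rewrite ltn_eqF //; lia.
case: ltnP => xv.
  rewrite (ltn_eqF xv) mulr0 addr0.
  have xz : (x - z1 < v)%N by lia.
  rewrite (bigD1 (Ordinal xz)) //= subnKC // eqxx big1 ?addr0 // => i ix.
  by move: ix; rewrite -val_eqE /= => ix; rewrite (_ : _ == _ = false) //; lia.
rewrite big1 ?add0r => [|i _]; last first.
  by rewrite (_ : _ == _ = false) //; have := ltn_ord i; lia.
by case: eqP; rewrite ?mulr1 ?mulr0.
Qed.

(** Next to the diagonal the two terms of symbol combine into differences of
    neighbouring binomial coefficients. *)
Lemma symbol_ballot n : (B < n + n)%N -> (z1 + v < n)%N ->
  symbol n.-1 n = \sum_(i < v) ballot K (n + n - B.+1) (n - (z1 + i).+1)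
                  + alpha * ballot K (n + n - B.+1) (n - (z1 + v).+1).
Proof.
case: n => // n Bn zn; rewrite /symbol /= !spreadE.
rewrite (_ : n + n.+1 - B = n.+1 + n.+1 - B.+1)%N; last by lia.
set m := (_ - _)%N.
have nE y : (y <= n)%N ->
  npaths y m n = 'C(m, n - y) /\ npaths y m n.+1 = 'C(m, (n - y).+1).
  by move=> yn; rewrite /npaths yn (leqW yn) !mul1n subSn.
have [|-> ->] := nE (z1 + v)%N; first by lia.
rewrite subSS /ballot mulrBr opprD addrACA; congr (_ + _).
rewrite -sumrB; apply: eq_bigr => i _; have [|-> ->] := nE (z1 + i)%N.
  by have := ltn_ord i; lia.
by rewrite subSS.
Qed.

(** Multiply the second equation by the factor of ballotSS: the terms of both
    equations become proportional with factors k i that increase strictly in i.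
    Subtracting k v times the first equation eliminates alpha and leaves a
    vanishing sum of positive terms. *)
Lemma no_two_zeros_next_to_diagonal n : (1 <= v)%N -> (z2 + v + 2 <= n)%N ->
  symbol n.-1 n = 0 -> symbol (n - 2) n.-1 = 0 -> False.
Proof.
move=> v1 zn.
rewrite (_ : n - 2 = n.-1.-1)%N; last by lia.
rewrite !symbol_ballot; [|lia..].
set m := (n.-1 + n.-1 - B.+1)%N.
rewrite (_ : n + n - B.+1 = m.+2)%N; last by lia.
pose q i := (n.-1 - (z1 + i).+1)%N.
pose k i := (((q i).+2 * (m.+1 - q i))%:R : K).
have scale i : (i <= v)%N ->
  (m.+2 * m.+1)%:R * ballot K m (q i) = k i * ballot K m.+2 (n - (z1 + i).+1).
  move=> iv; rewrite -ballotSS; last by rewrite /q /m; lia.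
  by congr (_ * ballot _ _ _); rewrite /q; lia.
move=> S1 /(congr1 (fun x => (m.+2 * m.+1)%:R * x)); rewrite mulr0 mulrDr.
rewrite mulrCA scale // mulr_sumr.
under eq_bigr => i _ do rewrite scale ?(ltnW (ltn_ord i)) //.
move=> S2.
have : \sum_(i < v) (k v - k i) * ballot K m.+2 (n - (z1 + i).+1) = 0.
  under eq_bigr do rewrite mulrBl.
  rewrite sumrB -mulr_sumr; set X := \sum_(i < v) _; set Y := \sum_(i < v) _.
  set Z := alpha * ballot K m.+2 (n - (z1 + v).+1).
  transitivity (k v * (X + Z) - (Y + k v * Z)); first by ring.
  by rewrite S1 /Z mulrCA S2 mulr0 subrr.
have pos (i : 'I_v) : 0 < (k v - k i) * ballot K m.+2 (n - (z1 + i).+1).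
  have iv := ltn_ord i.
  rewrite mulr_gt0 ?ballot_gt0; [by []| |lia..].
  rewrite subr_gt0 ltr_nat.
  have [d dE] : exists d, v = (i + d.+1)%N by exists (v - i.+1)%N; lia.
  have -> : (m.+1 - q v = m.+1 - q i + d.+1)%N by rewrite /q /m; lia.
  have -> : ((q i).+2 = (q v).+2 + d.+1)%N by rewrite /q; lia.
  have : (m.+1 - q i < (q v).+2)%N by rewrite /q /m; lia.
  by nia.
by move=> sum0; have := sum_ord_gt0 v1 pos; rewrite sum0 ltxx.
Qed.

(** Here B - b < z1 for the indices b used, so that the right-hand side of
    jacobi_mixed vanishes. *)
Lemma no_jacobi_large_z1 n : (1 <= v)%N ->
  (v + 5 <= z1 /\ 2 * n = z1 + 2 * z2 + v + 3)%N \/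
  (v + 6 <= z1 /\ 2 * n = z1 + 2 * z2 + v + 4)%N -> ~ symbol_jacobi n.
Proof.
move=> v1 nE jac; pose A := (z1 + v).-1.
have sA : seed A = 1 by apply: seed_one; lia.
have Eab : symbol n.-1 n = symbol (n - 2) n.
  rewrite symbol_rec ?symbolaa ?addr0; [|lia..].
  by congr symbol; lia.
case: nE => -[zv5 nE]; last first.
  have J1 : seed A * symbol (n - 2) n.-1 =
      seed (B - n.-1) * symbol A (n - 2) - seed (B - (n - 2)) * symbol A n.-1.
    by apply: jacobi_mixed jac _ _ _ _ _ _ _; lia.
  have J2 : seed A * symbol (n - 3) n =
      seed (B - n) * symbol A (n - 3) - seed (B - (n - 3)) * symbol A n.
    by apply: jacobi_mixed jac _ _ _ _ _ _ _; lia.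
  rewrite sA mul1r !seed_low ?mul0r ?subrr in J1; [|lia..].
  rewrite sA mul1r !seed_low ?mul0r ?subrr in J2; [|lia..].
  apply: (@no_two_zeros_next_to_diagonal n) => //; first by lia.
  rewrite Eab symbol_rec; [|lia..].
  by rewrite J1 addr0 (_ : (n - 2).-1 = n - 3)%N //; lia.
have J1 : seed A * symbol (n - 2) n =
    seed (B - n) * symbol A (n - 2) - seed (B - (n - 2)) * symbol A n.
  by apply: jacobi_mixed jac _ _ _ _ _ _ _; lia.
have J2 : seed (z1 + v) * symbol (n - 2) n.-1 =
    seed (B - n.-1) * symbol (z1 + v) (n - 2)
    - seed (B - (n - 2)) * symbol (z1 + v) n.-1.
  by apply: jacobi_mixed jac _ _ _ _ _ _ _; lia.
rewrite sA mul1r !seed_low ?mul0r ?subrr in J1; [|lia..].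
rewrite seed_alpha !seed_low ?mul0r ?subrr in J2; [|lia..].
rewrite J1 in Eab.
have [alpha0|alpha0] := eqVneq alpha 0; last first.
  apply: (@no_two_zeros_next_to_diagonal n) => //; first by lia.
  by apply: (mulfI alpha0); rewrite mulr0.
move: Eab; rewrite symbol_ballot ?alpha0 ?mul0r ?addr0; [|lia..].
have pos (i : 'I_v) : 0 < ballot K (n + n - B.+1) (n - (z1 + i).+1).
  by have iv := ltn_ord i; apply: ballot_gt0; lia.
by move=> sum0; have := sum_ord_gt0 v1 pos; rewrite sum0 ltxx.
Qed.

End Symbol.

Lemma symbol_jacobi_leq (K : numFieldType) z1 z2 v (alpha : K) m n :
  (m <= n)%N ->
  symbol_jacobi z1 z2 v alpha n -> symbol_jacobi z1 z2 v alpha m.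
Proof.
move=> mn jac a b d a2 b2 d2 am bm dm.
by apply: jac => //; apply: leq_trans mn.
Qed.

(** The hypothesis n <= 2 * z2 - 2 gives z2 >= 6 and z2 >= 7, respectively,
    in the two cases with v = 1 that are computed directly. *)
Lemma symbol_jacobi_bound (K : numFieldType) z1 z2 v (alpha : K) n :
  (4 <= z1)%N -> (z1 + v <= z2)%N -> (n <= 2 * z2 - 2)%N ->
  (v = 0%N -> alpha = 1) -> symbol_jacobi z1 z2 v alpha n ->
  (2 * n <= z1 + 2 * z2 + v + 2)%N.
Proof.
move=> z14 zv nz alpha1 jac; rewrite leqNgt; apply/negP => big.
have [n0 n0n n0E] : exists2 n0, (n0 <= n)%N &
  (2 * n0 = z1 + 2 * z2 + v + 3)%N \/ (2 * n0 = z1 + 2 * z2 + v + 4)%N.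
  exists ((z1 + 2 * z2 + v + 4)./2); lia.
have jac0 := symbol_jacobi_leq n0n jac.
have [v0|v0] := posnP v.
  apply: (no_jacobi_v0 z14 zv v0 (alpha1 v0) _ jac0); lia.
have [zbig|zsmall] := boolP ((v + 5 <= z1) && (2 * n0 == z1 + 2 * z2 + v + 3)
    || (v + 6 <= z1) && (2 * n0 == z1 + 2 * z2 + v + 4))%N.
  by apply: (no_jacobi_large_z1 z14 zv v0 _ jac0); lia.
have [v1|v2] : v = 1%N \/ (2 <= v)%N by lia.
  case: n0E => n0E.
    have jac1 : symbol_jacobi z1 z2 v alpha (z2 + 4).
      by apply: symbol_jacobi_leq jac0; lia.
    by apply: (no_jacobi_v1_odd z14 zv v1 _ _ jac1); lia.
  have jac1 : symbol_jacobi z1 z2 v alpha (z2 + 5).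
    by apply: symbol_jacobi_leq jac0; lia.
  by apply: (no_jacobi_v1_even z14 zv v1 _ _ jac1); lia.
case: n0E => n0E.
  by apply: (no_jacobi_odd z14 zv v2 _ n0E jac0); lia.
by apply: (no_jacobi_even z14 zv v2 _ n0E jac0); lia.
Qed.

(** * Coordinates and bilinearity *)

Section Coordinates.
Variables (K : fieldType) (g : vectType K) (n : nat) (e : n.-tuple g).

Fact bcoord_is_scalar h : scalar (bcoord e h).
Proof.
move=> a u v; rewrite /bcoord mulr_sumr -big_split /=.
by apply: eq_bigr => i _; rewrite linearP.
Qed.
HB.instance Definition _ h :=
  GRing.isLinear.Build K g K^o *:%R (bcoord e h) (@bcoord_is_scalar h).

(** The span of e_2, ..., e_k, as a slice of the basis so that its freeness
    is inherited. *)
Definition initial_space k : {vspace g} := <<drop 1 (take k e)>>.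

Lemma mem_initial_seq k x : (k <= n)%N -> x \in drop 1 (take k e) ->
  exists2 h, (2 <= h <= k)%N & x = bvec e h.
Proof.
move=> kn /(nthP 0)[j]; rewrite size_drop size_takel ?size_tuple // => jk <-.
by exists j.+2; rewrite ?nth_drop ?nth_take /bvec //=; lia.
Qed.

Lemma bvec_initial k h : (k <= n)%N -> (2 <= h <= k)%N ->
  bvec e h \in drop 1 (take k e).
Proof.
move=> kn; case: h => [|[|h]] // hk; apply/(nthP 0); exists h.
  by rewrite size_drop size_takel ?size_tuple //; lia.
by rewrite nth_drop nth_take.
Qed.

Hypothesis e_basis : basis_of {:g} e.

Lemma bcoord_bvec h k : bcoord e h (bvec e k) = ((0 < k <= n)%N && (h == k))%:R.
Proof.
have [k_in|k_out] := boolP (0 < k <= n)%N; last first.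
  have -> : bvec e k = 0.
    case: k k_out => // k; rewrite /bvec /= -ltnNge => nk.
    by rewrite nth_default ?size_tuple.
  by rewrite linear0.
case: k k_in => // k /= kn; rewrite /bvec /= /bcoord.
have e_free := basis_free e_basis.
under eq_bigr => i _ do rewrite (coord_free (Ordinal kn) i e_free).
have [->|hk] := eqVneq h k.+1.
  rewrite (bigD1 (Ordinal kn)) //= eqxx big1 ?addr0 // => i /andP[/eqP[ik]].
  by rewrite -val_eqE /= ik eqxx.
rewrite big1 // => i /eqP ih; rewrite -val_eqE /= (_ : _ == _ = false) //.
by apply/negbTE; apply: contraNneq hk => ik; rewrite -ih -ik.
Qed.

Lemma initial_space_coord k h u : (k <= n)%N -> ~~ (2 <= h <= k)%N ->
  u \in initial_space k -> bcoord e h u = 0.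
Proof.
move=> kn hk; rewrite /initial_space -[drop 1 _]in_tupleE => /coord_span->.
rewrite linear_sum big1 // => i _; rewrite linearZ /=.
have /(mem_initial_seq kn)[j jk ->] :
    (in_tuple (drop 1 (take k e)))`_i \in drop 1 (take k e).
  by rewrite mem_nth //; case: i => i /=; rewrite ?size_tuple.
rewrite bcoord_bvec; case: eqP => [hj|]; first by rewrite hj jk in hk.
by rewrite andbF scaler0.
Qed.

Lemma mem_initial_space k u : (k <= n)%N ->
  (forall h, (0 < h <= n)%N -> ~~ (2 <= h <= k)%N -> bcoord e h u = 0) ->
  u \in initial_space k.
Proof.
move=> kn u0; rewrite (bcoordK u e_basis) big_seq_cond; apply: memv_suml => h.
rewrite mem_index_iota andbT => hn; have [hk|hk] := boolP (2 <= h <= k)%N.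
  by apply/memvZ/memv_span/bvec_initial.
by rewrite u0 ?scale0r ?mem0v //; lia.
Qed.

Lemma dim_initial_space k : (k <= n)%N -> \dim (initial_space k) = k.-1.
Proof.
move=> kn; have : free e := basis_free e_basis.
rewrite -{1}[val e](cat_take_drop k) => /catl_free.
rewrite -[take k e](cat_take_drop 1) => /catr_free /eqP.
by rewrite size_drop size_takel ?size_tuple // subn1.
Qed.

End Coordinates.

Section Lie.
Variables (K : fieldType) (g : vectType K) (br : g -> g -> g).
Hypothesis br_lie : lie_bracket br.

Lemma lieC x y : br x y = - br y x.
Proof.
have brDl u v w : br (u + v) w = br u w + br v w.
  by have := lie_linearl br_lie w 1 u v; rewrite !scale1r.
have brDr u v w : br u (v + w) = br u v + br u w.
  by have := lie_linearr br_lie u 1 v w; rewrite !scale1r.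
have := lie_alternating br_lie (x + y); rewrite brDl !brDr.
rewrite !(lie_alternating br_lie) add0r addr0 => /eqP.
by rewrite addr_eq0 => /eqP.
Qed.

Lemma lie0r x : br x 0 = 0.
Proof.
have := lie_linearr br_lie x (-1) 0 0.
by rewrite scaler0 addr0 scaleN1r addNr.
Qed.

Lemma lie0l x : br 0 x = 0.
Proof. by rewrite lieC lie0r oppr0. Qed.

Lemma lie_sumr I (r : seq I) (c : I -> K) (u : I -> g) x :
  br x (\sum_(i <- r) c i *: u i) = \sum_(i <- r) c i *: br x (u i).
Proof.
elim: r => [|i r IHr]; first by rewrite !big_nil lie0r.
by rewrite !big_cons (lie_linearr br_lie) IHr.
Qed.

Lemma lie_suml I (r : seq I) (c : I -> K) (u : I -> g) x :
  br (\sum_(i <- r) c i *: u i) x = \sum_(i <- r) c i *: br (u i) x.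
Proof.
elim: r => [|i r IHr]; first by rewrite !big_nil lie0l.
by rewrite !big_cons (lie_linearl br_lie) IHr.
Qed.

Lemma lie_space_span (X Y : seq g) (W : {vspace g}) :
  {in X & Y, forall x y, br x y \in W} -> (lie_space br <<X>> <<Y>> <= W)%VS.
Proof.
move=> brW; apply/(lie_spaceP _ _ _ br_lie) => u v.
rewrite -[X]in_tupleE -[Y]in_tupleE => /coord_span-> /coord_span->.
rewrite lie_suml; apply: memv_suml => i _; apply: memvZ.
rewrite lie_sumr; apply: memv_suml => j _; apply: memvZ.
by apply: brW; rewrite mem_nth //= ?[X in (_ < X)%N](_ : _ = size _).
Qed.

(** The Jacobi identity in the form that each ad x is a derivation. *)
Lemma lie_jacobi_swap x y z :
  br x (br y z) = br (br x y) z + br y (br x z).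
Proof.
have := lie_jacobi br_lie x y z; rewrite (lieC z (br x y)) => /eqP.
rewrite subr_eq0 => /eqP <-; rewrite -addrA (lieC z x).
suff -> : br y (- br x z) = - br y (br x z) by rewrite addNr addr0.
by have := lie_linearr br_lie y (-1) (br x z) 0; rewrite !scaleN1r lie0r !addr0.
Qed.
End Lie.

(** * The leading part of a filiform bracket *)

Section LeadingPart.
Variables (K : numFieldType) (g : vectType K) (br : g -> g -> g) (n : nat).
Variable e : n.-tuple g.
Hypotheses (br_filiform : filiform br n) (e_adapted : adapted_basis br e).
Hypothesis n_ge4 : (4 <= n)%N.

Local Notation E := (bvec e).
Definition bracket_coord h a b : K := bcoord e h (br (E a) (E b)).
Local Notation F := bracket_coord.

Let br_lie : lie_bracket br. Proof. by case: br_filiform. Qed.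
Let e_basis : basis_of {:g} e. Proof. by case: e_adapted. Qed.

Lemma bracket_coordC h a b : F h a b = - F h b a.
Proof. by rewrite /bracket_coord lieC // linearN. Qed.

Lemma bracket_e2 a : (0 < a <= n)%N -> br (E 2) (E a) = 0.
Proof. by case: e_adapted => _ _ e2 _ a_in; apply: e2; lia. Qed.

Lemma bracket_coord_e2 h a : (0 < a <= n)%N -> F h 2 a = 0.
Proof. by move=> a_in; rewrite /bracket_coord bracket_e2 ?linear0. Qed.

Lemma bracket_e1 a : (3 <= a <= n)%N -> br (E 1) (E a) = E a.-1.
Proof. by case: e_adapted => _ e1 _ _ a_in; apply: e1. Qed.

Lemma bcoord_shift h x : (2 <= h < n)%N ->
  bcoord e h (br (E 1) x) = bcoord e h.+1 x.
Proof.
move=> /andP[h2 hn]; rewrite {1}(bcoordK x e_basis) lie_sumr // linear_sum.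
rewrite (bigD1_seq h.+1) ?mem_index_iota ?iota_uniq /=; [|lia|by []].
rewrite linearZ /= bracket_e1 /= ?bcoord_bvec //; last by lia.
rewrite eqxx (_ : (0 < h <= n)%N) ?[_ *: _]mulr1; last by lia.
rewrite big_seq_cond big1 ?addr0 // => k.
rewrite mem_index_iota => /andP[k_in kh].
rewrite linearZ /=; case: k k_in kh => [|[|[|k]]] // k_in kh.
- by rewrite lie_alternating // linear0 scaler0.
- by rewrite lieC // bracket_e2 ?oppr0 ?linear0 ?scaler0 //; lia.
rewrite bracket_e1 // bcoord_bvec //=.
by rewrite (_ : h == k.+2 = false) ?andbF ?scaler0 //; lia.
Qed.

Lemma bracket_coord_rec h a b : (2 <= h < n)%N ->
  (3 <= a <= n)%N -> (3 <= b <= n)%N ->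
  F h.+1 a b = F h a.-1 b + F h a b.-1.
Proof.
move=> h_in a_in b_in; rewrite /bracket_coord -bcoord_shift //.
by rewrite lie_jacobi_swap // !bracket_e1 // linearD.
Qed.

(** One inclusion is clear from e_h = [e_1, e_(h+1)]; the dimension of C^2 g
    gives equality.  Hence no bracket has an e_1- or e_n-coordinate. *)
Lemma derived1E : derived_series br 1 = initial_space e n.-1.
Proof.
have dimC2 : \dim (derived_series br 1) = n.-2.
  by case: br_filiform => _ _ /(_ 2)/=; rewrite subn2; apply; lia.
apply/esym/eqP; rewrite eqEdim dimC2 dim_initial_space ?leq_pred // leqnn andbT.
apply/span_subvP => x /(mem_initial_seq (leq_pred n))[h h_in ->].
have -> : E h = br (E 1) (E h.+1) by rewrite bracket_e1 //; lia.
have := proj1 (lie_spaceP fullv fullv (derived_series br 1) br_lie).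
by move=> mem; apply: mem; rewrite ?subvv ?memvf.
Qed.

Lemma bracket_coord_out h a b : ~~ (2 <= h < n)%N -> F h a b = 0.
Proof.
move=> hn; apply: (@initial_space_coord _ _ _ _ e_basis n.-1); [lia..|].
rewrite -derived1E.
have := proj1 (lie_spaceP fullv fullv (derived_series br 1) br_lie).
by move=> mem; apply: mem; rewrite ?subvv ?memvf.
Qed.

(** The lowest level is described by an arbitrary seed and factor because it is
    instantiated in two ways, according to whether gamma_v vanishes. *)

Section Leading.
Variables (z1 z2 v : nat) (alpha lambda : K).
Local Notation B := (z1 + z2 + v).+1.
Hypotheses (z1_ge4 : (4 <= z1)%N) (zv : (z1 + v <= z2)%N) (vn : (z2 + v < n)%N).
Hypothesis lambda_neq0 : lambda != 0.
Hypothesis F2_low : forall a b, (2 <= a < b)%N -> (b <= n)%N ->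
  (a + b < B)%N -> F 2 a b = 0.
Hypothesis F2_base : forall a b, (2 <= a < b)%N -> (b <= n)%N ->
  (a + b = B)%N -> F 2 a b = lambda * seed z1 v alpha a.

Lemma bracket_coord_high h a b : (2 <= a <= n)%N -> (2 <= b <= n)%N ->
  (a + b + 2 < B + h)%N -> F h a b = 0.
Proof.
have [h_in|] := boolP (2 <= h < n)%N; last first.
  by move=> *; apply: bracket_coord_out.
elim: h h_in a b => // h IHh h_in a b a_in b_in abh.
have [h2|h2] := leqP h 1.
  have hE : h = 1%N by lia.
  rewrite hE in abh * => {IHh h_in}.
  have [ab|ba|->] := ltngtP a b; last first.
  - by rewrite /bracket_coord lie_alternating ?linear0.
  - by rewrite bracket_coordC F2_low ?oppr0 //; lia.
  - by rewrite F2_low //; lia.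
have [->|a2] := eqVneq a 2%N; first by rewrite bracket_coord_e2 //; lia.
have [->|b2] := eqVneq b 2%N.
  by rewrite bracket_coordC bracket_coord_e2 ?oppr0 //; lia.
by rewrite bracket_coord_rec ?IHh ?addr0 //; lia.
Qed.

(** Both sides satisfy the same recursion in m and agree on the level
    a + b = B. *)
Lemma bracket_coord_lead m a b : (2 <= a <= n)%N -> (2 <= b <= n)%N ->
  (a + b = B + m)%N -> (m + 2 <= n)%N ->
  F m.+2 a b = lambda * symbol z1 z2 v alpha a b.
Proof.
elim: m a b => [|m IHm] a b a_in b_in abB mn.
  rewrite symbol_base ?addn0 //; last by lia.
  wlog ab : a b a_in b_in abB / (a <= b)%N => [H|].
    have [ab|/ltnW ba] := leqP a b; first exact: H.
    by rewrite bracket_coordC H 1?addnC // -mulrN opprB.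
  have [abE|neq] := eqVneq a b.
    by rewrite abE subrr mulr0 /bracket_coord lie_alternating ?linear0.
  by rewrite F2_base ?[seed _ _ _ b]seed_high ?subr0 //; lia.
have [a2|a2] := eqVneq a 2%N.
  by rewrite a2 bracket_coord_e2 ?symbol_low ?mulr0 //; lia.
have [b2|b2] := eqVneq b 2%N.
  rewrite b2 bracket_coordC symbolC bracket_coord_e2; last by lia.
  by rewrite symbol_low ?oppr0 ?mulr0 //; lia.
rewrite bracket_coord_rec; [|lia..].
rewrite (@symbol_rec K z1 z2 v alpha a b); [|lia..].
rewrite mulrDr.
by congr (_ + _); apply: IHm; lia.
Qed.

(** In the expansion of [e_b, e_d] the e_h with h > B - a do not occur, and the
    brackets of e_a with e_h, h < B - a, lie below the lowest level. *)
Lemma leading_double_bracket a b d : (2 <= a <= n)%N -> (2 <= b <= n)%N ->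
  (2 <= d <= n)%N -> (a + b + d + 2 = B + B)%N -> (a + 2 <= B)%N ->
  bcoord e 2 (br (E a) (br (E b) (E d))) =
  lambda ^+ 2 * (symbol z1 z2 v alpha a (B - a) * symbol z1 z2 v alpha b d).
Proof.
move=> a_in b_in d_in abd aB.
have aBa : (a + (B - a) = B)%N by lia.
have vanish h : (0 < h <= n)%N -> h != (B - a)%N -> F h b d * F 2 a h = 0.
  move=> h_in hB; have [h2|h2] := leqP h 1.
    by rewrite bracket_coord_out ?mul0r //; lia.
  have [hBa|Bah] := ltnP h (B - a).
    by rewrite [F 2 a h]bracket_coord_high ?mulr0 //; lia.
  by rewrite bracket_coord_high ?mul0r //; lia.
rewrite [br (E b) _](bcoordK _ e_basis) lie_sumr // linear_sum.
under eq_bigr do rewrite linearZ.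
(* If B - a > n then no term remains, in accordance with the seed, which
   vanishes there because n > z2 + v. *)
have [Ban|nBa] := leqP (B - a) n.
  rewrite (bigD1_seq (B - a)%N) ?mem_index_iota ?iota_uniq /=; [|lia|by []].
  rewrite big_seq_cond big1 ?addr0; last first.
    by move=> h; rewrite mem_index_iota => /andP[h_in hB]; apply: vanish; lia.
  rewrite -!/(bracket_coord _ _ _) -[X in X *: _]/(bracket_coord _ _ _).
  have -> : F (B - a) b d = lambda * symbol z1 z2 v alpha b d.
    by rewrite (_ : B - a = (B - a - 2).+2)%N ?bracket_coord_lead //; lia.
  rewrite (@bracket_coord_lead 0) ?addn0 //; [|lia..].
  by rewrite /GRing.scale /=; ring.
rewrite symbol_base // (@seed_low _ z1) ?(@seed_high _ z1) ?subrr ?mul0r ?mulr0;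
  [|lia..].
rewrite big_seq_cond big1 // => h; rewrite mem_index_iota andbT => h_in.
by apply: vanish; lia.
Qed.

Lemma leading_jacobi : symbol_jacobi z1 z2 v alpha n.
Proof.
move=> a b d a2 b2 d2 an bn dn abd aB bB dB.
have lambda2 : lambda ^+ 2 != 0 by rewrite expf_neq0.
apply: (mulfI lambda2); rewrite mulr0 2!mulrDr.
rewrite -!leading_double_bracket; [|lia..].
by rewrite -!linearD lie_jacobi // linear0.
Qed.

Lemma derived2_leading : (n <= 2 * z2 - 2)%N -> (v = 0%N -> alpha = 1) ->
  (derived_series br 2 <= initial_space e z2)%VS.
Proof.
move=> nz alpha1.
have bound := symbol_jacobi_bound z1_ge4 zv nz alpha1 leading_jacobi.
rewrite /derived_series iterS -/(derived_series br 1) derived1E.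
apply: (lie_space_span br_lie) => x y.
move=> /(mem_initial_seq (leq_pred n))[a a_in ->].
move=> /(mem_initial_seq (leq_pred n))[b b_in ->].
apply: (mem_initial_space e_basis) => [|h h_in hz]; first by lia.
rewrite -/(F h a b); have [->|ab] := eqVneq a b.
  by rewrite /bracket_coord lie_alternating ?linear0.
have [h1|h2] := leqP h 1; first by rewrite bracket_coord_out //; lia.
by rewrite bracket_coord_high //; lia.
Qed.

End Leading.
End LeadingPart.

(** * Algebras of the family G *)

Section NormalForm.
Variables (K : numFieldType) (g : vectType K) (br : g -> g -> g).
Variables (n z1 z2 : nat).
Variables (e : n.-tuple g) (alpha gamma : nat -> K) (beta : nat -> nat -> K).
Hypotheses (hz1 : (4 <= z1)%N) (hz12 : (z1 <= z2)%N) (hz2n : (z2 < n)%N).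
Hypothesis hn : (n <= 2 * z2 - 2)%N.
Hypothesis br_F : familyF br z1 z2 e alpha gamma beta.
Hypothesis br_G : forall k l,
  (2 <= l <= n - z2)%N -> (1 <= k < z2 - z1 + l)%N ->
  (k + l <= n - z2)%N -> beta k l = gamma (k + l).-1.

Local Notation E := (bvec e).
Local Notation F := (bracket_coord br e).

Let br_filiform : filiform br n. Proof. by case: br_F. Qed.
Let e_adapted : adapted_basis br e. Proof. by case: br_F. Qed.
Let e_basis : basis_of {:g} e. Proof. by case: e_adapted. Qed.
Let br_lie : lie_bracket br. Proof. by case: br_filiform. Qed.

(** Only the last term of the sums of the normal form involves e_2. *)
Lemma bcoord2_sum (c : nat -> K) m : (0 < m)%N -> (m < n)%N ->
  bcoord e 2 (\sum_(1 <= s < m.+1) c s *: E (m.+2 - s)) = c m.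
Proof.
move=> m0 mn; rewrite big_nat_recr //= linearD linear_sum linearZ /=.
rewrite bcoord_bvec // big_nat big1 => [|s s_in]; last first.
  by rewrite linearZ /= bcoord_bvec // (_ : (2 == _)%N = false);
    [rewrite andbF scaler0|lia].
rewrite add0r (_ : (_ && _) = true) ?[_ *: _]mulr1 //; lia.
Qed.

Lemma bracket_coord_alpha i :
  (i <= z2 - z1)%N -> F 2 (z1 + i) z2.+1 = alpha i.+1.
Proof.
move=> iz; rewrite /bracket_coord; case: br_F => _ _ _ _ [_ -> // _ _ _].
under eq_bigr do rewrite addn3.
by rewrite bcoord2_sum //; lia.
Qed.

Lemma bracket_coord_gamma j : (2 <= j <= n - z2)%N ->
  F 2 z1 (z2 + j) = gamma j.-1.
Proof.
move=> jn; rewrite /bracket_coord; case: br_F => _ _ _ _ [_ _ -> // _ _].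
rewrite linearD linearZ /= bcoord_bvec //.
rewrite (_ : (2 == j.+1)%N = false) ?andbF ?scaler0 ?add0r; last by lia.
by case: j jn => // j jn; rewrite bcoord2_sum //; lia.
Qed.

Lemma bracket_coord_beta k l : (2 <= l <= n - z2)%N ->
  (1 <= k < z2 - z1 + l)%N -> F 2 (z1 + k) (z2 + l) = beta k l.
Proof.
move=> ln kl; rewrite /bracket_coord; case: br_F => _ _ _ _ [_ _ _ -> // _].
rewrite linearD linearZ /= bcoord_bvec // linear_sum big_nat big1 => [|h h_in].
  by rewrite add0r (_ : (_ && _) = true) ?[_ *: _]mulr1 //; lia.
by rewrite linearZ /= bcoord_bvec // (_ : (2 == _)%N = false);
    [rewrite andbF scaler0|lia].
Qed.

Lemma bracket_coord_other h a b : (2 <= a < b)%N -> (b <= n)%N ->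
  ~~ ((z1 <= a) && (z2 < b))%N -> F h a b = 0.
Proof.
move=> ab bn out; rewrite /bracket_coord; case: br_F => _ _ _ _ [_ _ _ _ ->].
- by rewrite linear0.
- by lia.
- by [].
- by apply/negP => /andP[/eqP]; lia.
- by [].
Qed.

(** The effect of the equations that define G inside F. *)
Lemma bracket_coord_structured a b : (z1 <= a < b)%N -> (z2 + 2 <= b <= n)%N ->
  (a + b <= n + z1)%N -> F 2 a b = gamma (a + b - z1 - z2).-1.
Proof.
move=> az bz abn.
rewrite (_ : b = z2 + (b - z2))%N; last by lia.
have [->|az1] := eqVneq a z1.
  by rewrite bracket_coord_gamma; [congr (gamma _.-1); lia|lia].
rewrite (_ : a = z1 + (a - z1))%N; last by lia.
rewrite bracket_coord_beta ?br_G; [|lia..].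
by congr (gamma _.-1); lia.
Qed.

(** The level a + b = z1 + z2 + v + 1 carries a nonzero parameter among the
    admissible alpha and gamma. *)
Definition level_nonzero v :=
  ((v <= z2 - z1)%N && (alpha v.+1 != 0)) ||
  ((1 <= v < n - z2)%N && (gamma v != 0)).

(** Otherwise [e_z2, e_(z2+1)] would vanish. *)
Lemma alpha_nonzero : exists2 i, (i <= z2 - z1)%N & alpha i.+1 != 0.
Proof.
have [[j]|none] :=
    altP (@existsP _ (fun i : 'I_(z2 - z1).+1 => alpha i.+1 != 0)).
  by exists j; rewrite // -ltnS ltn_ord.
case: br_F => _ _ _ [_ [[_ _ br_neq0] _]] [_ brE _ _ _].
case: br_neq0.
have := brE (z2 - z1)%N; rewrite subnKC // => -> //.
rewrite big_nat big1 // => s s_in.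
have sz : (s.-1 < (z2 - z1).+1)%N by lia.
move: none; rewrite negb_exists => /forallP/(_ (Ordinal sz)); rewrite negbK /=.
by rewrite prednK; [move=> /eqP->; rewrite scale0r|lia].
Qed.

(** Otherwise [e_z1, e_n] would vanish. *)
Lemma level_nonzero_lt : exists2 v, (v < n - z2)%N & level_nonzero v.
Proof.
have [[v]|none] := altP (@existsP _ (fun v : 'I_(n - z2) => level_nonzero v)).
  by exists v.
have {}none v : (v < n - z2)%N -> level_nonzero v = false.
  move=> vn; move: none.
  by rewrite negb_exists => /forallP/(_ (Ordinal vn))/negbTE.
have alpha1 : alpha 1 = 0.
  have := none 0%N; rewrite /level_nonzero /= orbF subn_gt0 => /(_ hz2n)/negbT.
  by rewrite negbK => /eqP.
case: br_F => _ _ _ [[[_ _ br_neq0] _] _] [_ brA brG _ _].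
case: br_neq0.
have [nE|nE] := eqVneq n z2.+1.
  have -> : E n = E z2.+1 by congr (bvec e _).
  have := brA 0%N isT; rewrite addn0 => ->.
  by rewrite big_nat1 alpha1 scale0r.
have := brG (n - z2)%N; rewrite subnKC ?(ltnW hz2n) // => -> //; last by lia.
rewrite alpha1 scale0r add0r big_nat big1 // => s s_in.
have := none s; rewrite /level_nonzero => /(_ ltac:(lia))/negbT.
rewrite negb_or negb_and => /andP[_].
rewrite (_ : (1 <= s < n - z2)%N) /=; last by lia.
by rewrite negbK => /eqP->; rewrite scale0r.
Qed.

(** At the lowest nonzero level, gamma_v is the common factor if it is nonzero;
    otherwise the level consists of alpha_(v+1) alone, which is the case v = 0
    for z1 + v in place of z1. *)
Lemma derived2_sub_initial : (derived_series br 2 <= initial_space e z2)%VS.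
Proof.
have exv : exists v, level_nonzero v.
  by have [v _] := level_nonzero_lt; exists v.
case: (ex_minnP exv) => v vQ v_min.
have vz : (v <= z2 - z1)%N.
  have [i iz ai] := alpha_nonzero; apply: leq_trans (iz); apply: v_min.
  by rewrite /level_nonzero iz ai.
have vn : (v < n - z2)%N.
  have [w wn wQ] := level_nonzero_lt.
  by apply: leq_ltn_trans (wn); apply: v_min.
have below w : (w < v)%N -> alpha w.+1 = 0 /\ ((1 <= w)%N -> gamma w = 0).
  move=> wv; have : ~~ level_nonzero w.
    by apply: contraL wv => /v_min; rewrite leqNgt.
  rewrite negb_or !negb_and !negbK => /andP[a0 g0]; split.
    by move: a0; rewrite (_ : (w <= z2 - z1)%N) => [/eqP //|]; lia.
  move=> w1; move: g0; rewrite w1 /= (_ : (w < n - z2)%N) => [/eqP //|]; lia.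
have F2_low a b : (2 <= a < b)%N -> (b <= n)%N ->
    (a + b < (z1 + z2 + v).+1)%N ->
    F 2 a b = 0.
  move=> ab bn abv.
  have [/andP[az bz]|out] := boolP ((z1 <= a) && (z2 < b))%N; last first.
    exact: bracket_coord_other.
  have [bE|bz2] := eqVneq b z2.+1.
    rewrite bE (_ : a = z1 + (a - z1))%N; last by lia.
    by rewrite bracket_coord_alpha; [apply: (below _ _).1|]; lia.
  rewrite bracket_coord_structured; [|lia..].
  by apply: (below _ _).2; lia.
have F2_base a b : (2 <= a < b)%N -> (b <= n)%N ->
    (a + b = (z1 + z2 + v).+1)%N ->
    F 2 a b = if (a < z1)%N then 0 else if (a < z1 + v)%N then gamma v
              else if a == (z1 + v)%N then alpha v.+1 else 0.
  move=> ab bn abv; case: ltnP => az.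
    by rewrite bracket_coord_other //; lia.
  case: ltnP => av.
    by rewrite bracket_coord_structured; [congr gamma; lia|lia..].
  case: eqP => [aE|aE]; last by rewrite bracket_coord_other //; lia.
  by rewrite aE (_ : b = z2.+1) ?bracket_coord_alpha //; lia.
have [gv|gv] := boolP ((0 < v)%N && (gamma v != 0)).
  have [v0 gv0] := andP gv.
  apply: (@derived2_leading _ _ _ _ _ br_filiform e_adapted _ z1 z2 v
    (alpha v.+1 / gamma v) (gamma v)) => //; [lia|lia|lia|..|lia].
  move=> a b ab bn abv; rewrite F2_base // /seed.
  do 3?[case: ifP => _]; rewrite ?mulr0 ?mulr1 //.
  by rewrite mulrCA divff ?mulr1.
have av : alpha v.+1 != 0.
  move: vQ; rewrite /level_nonzero => /orP[/andP[] //|/andP[/andP[v0 _] gv0]].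
  by rewrite v0 gv0 in gv.
apply: (@derived2_leading _ _ _ _ _ br_filiform e_adapted _
    (z1 + v) z2 0 1 (alpha v.+1))
  => //; [lia|lia|lia|lia|..].
  by move=> a b ab bn abv; apply: F2_low => //; lia.
move=> a b ab bn abv; rewrite F2_base //; last by lia.
rewrite /seed addn0; case: (ltngtP a (z1 + v)) => [av'|av'|->]; last first.
- by rewrite ltnNge leq_addr /= mulr1.
- by rewrite ltnNge (leq_trans _ (ltnW av')) ?leq_addr //= mulr0.
rewrite mulr0; case: ifP => // az; apply/eqP; move: gv; rewrite negb_and negbK.
by case/orP => //; lia.
Qed.

Lemma derived3_familyG : derived_series br 3 = 0%VS.
Proof.
apply/eqP; rewrite -subv0 /derived_series iterS -/(derived_series br 2).
apply/(lie_spaceP _ _ _ br_lie) => x y /(subvP derived2_sub_initial) xz.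
move=> /(subvP derived2_sub_initial) yz.
suff /(lie_spaceP _ _ _ br_lie) : (lie_space br (initial_space e z2)
    (initial_space e z2) <= 0)%VS by apply.
apply: (lie_space_span br_lie) => u w.
move=> /(mem_initial_seq (ltnW hz2n))[a a_in ->].
move=> /(mem_initial_seq (ltnW hz2n))[b b_in ->].
have zero c d : (2 <= c < d)%N -> (d <= z2)%N -> br (E c) (E d) = 0.
  by move=> cd dz; case: br_F => _ _ _ _ [_ _ _ _ ->] //; lia.
rewrite memv0.
case: (ltngtP a b) => [ab|ba|->]; last by rewrite lie_alternating.
- by rewrite zero //; lia.
- by rewrite lieC // zero ?oppr0 //; lia.
Qed.

End NormalForm.

Lemma has_derived_length_leq (K : fieldType) (g : vectType K)
    (br : g -> g -> g) k :
  derived_series br k = 0%VS -> exists m, (m <= k)%N /\ has_derived_length br m.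
Proof.
move=> /eqP dk.
case: (ex_minnP (ex_intro (fun m => derived_series br m == 0%VS) k dk)).
move=> m /eqP dm m_min.
exists m; split; first exact: m_min.
by split=> // j jm /eqP /m_min; rewrite leqNgt jm.
Qed.

Theorem theorem3 (R : realType) (n z1 z2 : nat)
    (hz1 : (4 <= z1)%N) (hz12 : (z1 <= z2)%N) (hz2n : (z2 < n)%N)
    (hn : (n <= 2 * z2 - 2)%N)
    (g : vectType R[i]) (br : g -> g -> g)
    (g_filiform : filiform br n) (g_in_G : in_familyG br n z1 z2) :
  (exists m : nat, (m <= 3)%N /\ has_derived_length br m) /\
  derived_series br 3 = 0%VS.
Proof.
have D3 : derived_series br 3 = 0%VS.
  have [e [alpha [gamma [beta [inF inG]]]]] := g_in_G.
  exact: derived3_familyG hz1 hz12 hz2n hn inF inG.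
by split=> //; apply: has_derived_length_leq.
Qed.
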